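(* Let $q=2^{2n+1}$ with $n$ a positive integer. The maximal subgroup $\mathrm{Sz}(q)$ of $\mathrm{Sp}_4(q)$ is not a strong Gelfand subgroup, i.e. $(\mathrm{Sp}_4(q),\mathrm{Sz}(q))$ is not a strong Gelfand pair.
   Context: All characters are complex. A pair $(G,H)$ with $H\le G$ finite is a strong Gelfand pair (and $H$ a strong Gelfand subgroup) if for every irreducible character $\psi$ of $H$, the induced character $\psi\uparrow G$ satisfies $\langle \psi\uparrow G,\chi\rangle\le 1$ for every irreducible character $\chi$ of $G$. $\mathrm{Sp}_4(q)$ is the symplectic group of a nondegenerate alternating form on $\mathbb{F}_q^4$; $\mathrm{Sz}(q)$ is the Suzuki group of order $q^2(q^2+1)(q-1)$, embedded in $\mathrm{Sp}_4(q)$ as a maximal subgroup when $q$ is an odd power of $2$. *)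

(* Defs.v *)
From HB Require Import structures.
From mathcomp Require Import all_boot all_order all_algebra all_fingroup all_solvable all_field all_character.
Set Implicit Arguments. Unset Strict Implicit. Unset Printing Implicit Defensive.
Import GRing.Theory Num.Theory.
Local Open Scope ring_scope.

Definition strong_gelfand (gT : finGroupType) (G H : {group gT}) : Prop :=
  forall (i : Iirr H) (j : Iirr G), '['Ind[G] 'chi[H]_i, 'chi[G]_j] <= 1.

Section Sp4Sz.
Variable F : finFieldType.

Definition mx4 (a00 a01 a02 a03 a10 a11 a12 a13 a20 a21 a22 a23
                a30 a31 a32 a33 : F) : 'M[F]_4 :=
  \matrix_(i < 4, j < 4)
    nth 0 (nth [::] [:: [:: a00; a01; a02; a03]; [:: a10; a11; a12; a13];
                         [:: a20; a21; a22; a23]; [:: a30; a31; a32; a33]] i) j.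

(* Gram matrix of the nondegenerate alternating form with
   f(e1,e4) = f(e2,e3) = 1 (alternating since char F = 2 in our use). *)
Definition Jform : 'M[F]_4 := mx4 0 0 0 1  0 0 1 0  0 1 0 0  1 0 0 0.

Definition Sp4_set : {set {'GL_4[F]}} :=
  [set g : {'GL_4[F]} | (GLval g)^T *m Jform *m GLval g == Jform].

Lemma Sp4_group_set : group_set Sp4_set.
Proof.
apply/andP; split.
  by rewrite inE GL_1E trmx1 mul1mx mulmx1.
apply/subsetP=> _ /imset2P[g h Hg Hh ->].
rewrite !inE in Hg Hh *; rewrite GL_MxE trmx_mul.
set G := GLval g in Hg *; set H := GLval h in Hh *.
have -> : H^T *m G^T *m Jform *m (G *m H) = H^T *m (G^T *m Jform *m G) *m H
  by rewrite !mulmxA.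
by rewrite (eqP Hg).
Qed.

Canonical Sp4 : {group {'GL_4[F]}} := Group Sp4_group_set.

(* Suzuki group Sz(q), q = 2^(2n+1), following Wilson, "The Finite Simple
   Groups", 4.2: theta is the field automorphism x |-> x^(2^(n+1)). *)
Variable n : nat.
Definition sz_theta : nat := 2 ^ n.+1.

Definition sz_S (a b : F) : 'M[F]_4 :=
  mx4 1 0 0 0
      a 1 0 0
      b (a ^+ sz_theta) 1 0
      (a ^+ (2 + sz_theta) + a * b + b ^+ sz_theta)
        (a ^+ (1 + sz_theta) + b) a 1.

Definition sz_M (l : F) : 'M[F]_4 :=
  mx4 (l ^+ (1 + 2 ^ n)) 0 0 0
      0 (l ^+ (2 ^ n)) 0 0
      0 0 (l ^+ (2 ^ n))^-1 0
      0 0 0 (l ^+ (1 + 2 ^ n))^-1.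

Definition sz_W : 'M[F]_4 := mx4 0 0 0 1  0 0 1 0  0 1 0 0  1 0 0 0.

Definition Sz_gens : {set {'GL_4[F]}} :=
  [set g : {'GL_4[F]} |
     [|| [exists a : F, exists b : F, GLval g == sz_S a b],
         [exists l : F, (l != 0) && (GLval g == sz_M l)]
       | GLval g == sz_W]].

Definition Sz : {group {'GL_4[F]}} := <<Sz_gens>>%G.

End Sp4Sz.

(* Main.v *)
(** Let K be the Borel subgroup of H = Sz(q), of order at most q^2(q-1), B that
    of G = Sp4(q), and mu a nontrivial linear character of K, trivial on its
    unipotent radical.  Since H = K u KWK and mu is not fixed by W, Ind_K^H mu
    is irreducible; since G is the union of 8 double cosets B w B, Ind_B^G 1 has
    norm at most 8.  If (G, H) were a strong Gelfand pair, the scalar product of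
    Ind_K^G mu and Ind_B^G 1 would thus be at most 8.  By Mackey it is at least
    N / (|K| |B|), where N is the number of g in G such that mu is trivial on
    K n gBg^-1.  Every other g is such that gB is fixed by a conjugate of some
    M(l) with l <> 1; having distinct eigenvalues, M(l) only fixes the 8
    coordinate flags, so there are at most 8 q^2 |B| such g.  Hence
    |G| <= 8 q^2 (q-1) |B| + 8 q^2 |B| = 8 q^3 |B| <= q^4 |B|, whereas
    |G| > q^4 |B| by counting the cosets of B. *)
From mathcomp Require Import all_boot all_order all_algebra all_fingroup all_solvable all_field all_character.
From mathcomp Require Import ring zify.
Require Import Defs.
Set Implicit Arguments. Unset Strict Implicit. Unset Printing Implicit Defensive.
Import Order.TTheory GRing.Theory Num.Theory.
Local Open Scope ring_scope.

(** * Multiplicities in strong Gelfand pairs *)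

(** With [theta] and [pi] expanded in irreducibles with multiplicities [a_i] and [b_j], the left
    side is a sum of [a_i * m_ij * b_j] with [m_ij <= 1]. Since [a_i] and [b_j] are natural numbers,
    each is at most its square. *)
Lemma strong_gelfand_cfdot_Ind (gT : finGroupType) (G H : {group gT})
    (theta : 'CF(H)) (pi : 'CF(G)) :
    strong_gelfand G H -> theta \is a character -> pi \is a character ->
  '['Ind[G] theta, pi] <= '[theta] * '[pi].
Proof.
move=> sgGH Nth Npi.
have le_sqr (a : algC) : a \in Num.nat -> a <= a * a^*.
  move=> Na; have /natrP[m ->] := Na; rewrite conj_natr ?natr_nat // -natrM.
  by rewrite ler_nat; case: m => // m; rewrite leq_pmulr.
rewrite !cfdot_sum_irr mulr_suml.
rewrite (eq_bigr (fun j => \sum_i '[theta, 'chi_i] *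
            ('['Ind[G] 'chi_i, 'chi_j] * '[pi, 'chi_j]))); last first.
  move=> j _; rewrite {1}[theta]cfun_sum_cfdot linear_sum cfdot_suml mulr_suml.
  apply: eq_bigr => i _; rewrite linearZ cfdotZl -mulrA; congr (_ * (_ * _)).
  by rewrite conj_natr ?Cnat_cfdot_char_irr.
rewrite exchange_big; apply: ler_sum => i _; rewrite mulr_sumr.
have Na := Cnat_cfdot_char_irr i Nth.
apply: ler_sum => j _; have Nb := Cnat_cfdot_char_irr j Npi.
apply: ler_pM (le_sqr _ Na) _; rewrite ?natr_ge0 //.
  by rewrite rpredM // Cnat_cfdot_char ?cfInd_char ?irr_char.
apply: le_trans (le_sqr _ Nb).
by rewrite -[leRHS]mul1r ler_wpM2r ?natr_ge0.
Qed.

(** * Mackey's formula for linear characters *)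

Section Mackey.
Variables (gT : finGroupType) (G A B : {group gT}).
Hypotheses (sAG : A \subset G) (sBG : B \subset G).

(** Mackey's formula summed over all of [G] instead of double coset representatives, which makes the
    terms countable one element at a time. *)
Lemma cfdot_Ind_Ind (mu : 'CF(A)) (nu : 'CF(B)) :
  '['Ind[G] mu, 'Ind[G] nu] = (#|A| * #|B|)%:R^-1 *
     \sum_(g in G) \sum_(x in (A :&: B :^ g^-1)%g) mu x * (nu (x ^ g)%g)^*.
Proof.
rewrite -Frobenius_reciprocity cfdotE natrM invfM -mulrA; congr (_ * _).
under eq_bigr => x Ax.
  rewrite cfResE // cfIndE // rmorphM fmorphV rmorph_nat rmorph_sum.
  rewrite mulrCA mulr_sumr; over.
rewrite -mulr_sumr exchange_big /=; congr (_ * _); apply: eq_bigr => g Gg.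
rewrite [LHS](big_setID (B :^ g^-1)%g) /= [X in _ + X]big1 ?addr0 // => x.
by rewrite inE mem_conjgV => /andP[/cfun0-> _]; rewrite conjC0 mulr0.
Qed.

Variables (mu : 'CF(A)) (nu : 'CF(B)).
Hypotheses (lin_mu : mu \is a linear_char) (lin_nu : nu \is a linear_char).

(** For linear characters the values are roots of unity, so the product is 1 exactly when [mu] and
    the conjugate of [nu] coincide at [x]. *)
Definition mackey_agree (g : gT) :=
  [forall x in (A :&: B :^ g^-1)%g, mu x * (nu (x ^ g)%g)^* == 1].

(** Orthogonality: the summand is a linear character of the intersection, and translating by an
    element where it differs from 1 rescales the sum, which must vanish. *)
Lemma mackey_term (g : gT) :
  \sum_(x in (A :&: B :^ g^-1)%g) mu x * (nu (x ^ g)%g)^* =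
    (mackey_agree g * #|(A :&: B :^ g^-1)%g|)%:R.
Proof.
have [/forall_inP agree | ] := boolP (mackey_agree g).
  by rewrite mul1n -sumr_const; apply: eq_bigr => x /agree/eqP.
rewrite negb_forall_in => /exists_inP[y Dy ne1]; rewrite mul0n.
set D := A :&: _ in Dy *; pose f x : algC := mu x * (nu (x ^ g)%g)^*.
have fM x : x \in D -> f (x * y)%g = f x * f y.
  rewrite !inE !mem_conjgV in Dy * => /andP[Ax Bx]; case/andP: Dy => Ay By.
  by rewrite /f (lin_charM lin_mu) // conjMg (lin_charM lin_nu) // rmorphM mulrACA.
apply: contraNeq ne1 => nz_sum; rewrite -[_ * _]/(f y); apply/eqP.
apply: (mulfI nz_sum); rewrite mulr1 mulr_suml.
rewrite (eq_bigr (fun x => f (x * y)%g)) => [|x /fM->//].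
rewrite [RHS](reindex_inj (mulIg y)) /=; apply: eq_bigl => x.
by rewrite (groupMr _ Dy).
Qed.

Lemma cfdot_Ind_ge :
  #|[set g in G | mackey_agree g]|%:R
    <= (#|A| * #|B|)%:R * '['Ind[G] mu, 'Ind[G] nu].
Proof.
rewrite cfdot_Ind_Ind mulVKf ?pnatr_eq0 ?muln_eq0 ?negb_or -?lt0n ?cardG_gt0 //.
rewrite -sum1dep_card natr_sum big_mkcondr /=; apply: ler_sum => g _.
rewrite mackey_term; case: mackey_agree; rewrite ?ler0n // mul1n ler_nat.
exact: cardG_gt0.
Qed.

(** The double coset is a translate of the product of [A] and a conjugate of [B], so this is the
    product formula for two subgroups. *)
Lemma card_mackey (a b w : gT) : a \in A -> b \in B ->
  (#|(A :* w * B)%g| * #|(A :&: B :^ (a * w * b)^-1)%g|)%N = (#|A| * #|B|)%N.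
Proof.
move=> Aa Bb; pose C := (B :^ w^-1)%G.
have -> : (A :&: B :^ (a * w * b)^-1)%g = ((A :&: C) :^ a^-1)%g.
  by rewrite conjIg (conjGid (groupVr Aa)) !invMg !conjsgM (conjGid (groupVr Bb)).
have -> : (A :* w * B)%g = ((A * C) :* w)%g.
  by rewrite /C /= conjsgE invgK !mulgA -[RHS]mulgA mulg_set1 mulVg mulg1.
by rewrite card_rcoset cardJg -mul_cardG cardJg.
Qed.

Lemma cfdot_Ind_le (I : finType) (w : I -> gT) :
    {in G, forall g, mackey_agree g -> exists i, g \in (A :* w i * B)%g} ->
  '['Ind[G] mu, 'Ind[G] nu] <= #|I|%:R.
Proof.
move=> cover; rewrite cfdot_Ind_Ind.
have AB_gt0 : 0 < (#|A| * #|B|)%:R :> algC.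
  by rewrite ltr0n muln_gt0 !cardG_gt0.
rewrite mulrC ler_pdivrMr // -sumr_const mulr_suml.
(* Each term is charged to every double coset containing [g]; overlaps only increase the bound. A
   single double coset receives [#|A| * #|B|] in total. *)
pose T i g : algC :=
  if g \in (A :* w i * B)%g then #|(A :&: B :^ g^-1)%g|%:R else 0.
have T0 i g : 0 <= T i g by rewrite /T; case: ifP => _ //; apply: ler0n.
apply: le_trans (_ : \sum_(g in G) \sum_i T i g <= _).
  apply: ler_sum => g Gg; rewrite mackey_term.
  case: (boolP (mackey_agree g)) => [/(cover g Gg)[i ABg] | _]; last first.
    by rewrite mul0n sumr_ge0.
  by rewrite (bigD1 i) //= mul1n {1}/T ABg lerDl sumr_ge0.
rewrite exchange_big; apply: ler_sum => i _.
apply: le_trans (_ : \sum_(g in (A :* w i * B)%g) T i g <= _).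
  rewrite [leRHS]big_mkcond [leLHS]big_mkcond; apply: ler_sum => g _.
  by case: ifP => _; case: ifP => // ABg; rewrite /T ABg.
have nz_coset : #|(A :* w i * B)%g|%:R != 0 :> algC.
  rewrite pnatr_eq0 -lt0n card_gt0; apply/set0Pn; exists (1 * w i * 1)%g.
  by rewrite mem_mulg ?mem_rcoset ?mulgK.
pose c := (#|A| * #|B|)%:R / #|(A :* w i * B)%g|%:R : algC.
rewrite (eq_bigr (fun => c)) => [|g ABg].
  by rewrite sumr_const mul1r -[leLHS]mulr_natr divfK.
rewrite /T ABg; case/mulsgP: ABg => _ b /rcosetP[a Aa ->] Bb ->.
by rewrite /c -(card_mackey (w i) Aa Bb) natrM mulrC mulKf.
Qed.
End Mackey.

(** * Symplectic 4 x 4 matrices *)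

Section MatrixGroups.
Variable F : finFieldType.

Lemma mulmx4 (a00 a01 a02 a03 a10 a11 a12 a13 a20 a21 a22 a23 a30 a31 a32 a33
              b00 b01 b02 b03 b10 b11 b12 b13 b20 b21 b22 b23 b30 b31 b32 b33 : F) :
  mx4 a00 a01 a02 a03 a10 a11 a12 a13 a20 a21 a22 a23 a30 a31 a32 a33 *m
  mx4 b00 b01 b02 b03 b10 b11 b12 b13 b20 b21 b22 b23 b30 b31 b32 b33 =
  mx4 (a00 * b00 + a01 * b10 + a02 * b20 + a03 * b30)
      (a00 * b01 + a01 * b11 + a02 * b21 + a03 * b31)
      (a00 * b02 + a01 * b12 + a02 * b22 + a03 * b32)
      (a00 * b03 + a01 * b13 + a02 * b23 + a03 * b33)
      (a10 * b00 + a11 * b10 + a12 * b20 + a13 * b30)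
      (a10 * b01 + a11 * b11 + a12 * b21 + a13 * b31)
      (a10 * b02 + a11 * b12 + a12 * b22 + a13 * b32)
      (a10 * b03 + a11 * b13 + a12 * b23 + a13 * b33)
      (a20 * b00 + a21 * b10 + a22 * b20 + a23 * b30)
      (a20 * b01 + a21 * b11 + a22 * b21 + a23 * b31)
      (a20 * b02 + a21 * b12 + a22 * b22 + a23 * b32)
      (a20 * b03 + a21 * b13 + a22 * b23 + a23 * b33)
      (a30 * b00 + a31 * b10 + a32 * b20 + a33 * b30)
      (a30 * b01 + a31 * b11 + a32 * b21 + a33 * b31)
      (a30 * b02 + a31 * b12 + a32 * b22 + a33 * b32)
      (a30 * b03 + a31 * b13 + a32 * b23 + a33 * b33).
Proof.
apply/matrixP=> i j; rewrite mxE !big_ord_recl big_ord0 !mxE /= addr0 !addrA.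
by case: i => [[|[|[|[|i]]]] //= _]; case: j => [[|[|[|[|j]]]] //= _].
Qed.

Lemma trmx4 (a00 a01 a02 a03 a10 a11 a12 a13 a20 a21 a22 a23 a30 a31 a32 a33 : F) :
  (mx4 a00 a01 a02 a03 a10 a11 a12 a13 a20 a21 a22 a23 a30 a31 a32 a33)^T =
  mx4 a00 a10 a20 a30 a01 a11 a21 a31 a02 a12 a22 a32 a03 a13 a23 a33.
Proof.
apply/matrixP=> i j; rewrite !mxE.
by case: i => [[|[|[|[|i]]]] //= _]; case: j => [[|[|[|[|j]]]] //= _].
Qed.

Lemma mx4_1 : 1%:M = mx4 1 0 0 0 0 1 0 0 0 0 1 0 0 0 0 1 :> 'M[F]_4.
Proof.
apply/matrixP=> i j; rewrite !mxE -val_eqE.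
by case: i => [[|[|[|[|i]]]] //= _]; case: j => [[|[|[|[|j]]]] //= _].
Qed.

Definition symplectic (A : 'M[F]_4) := A^T *m Jform F *m A = Jform F.

Lemma JformK : Jform F *m Jform F = 1%:M.
Proof. by rewrite mulmx4 mx4_1; congr mx4; ring. Qed.

Lemma symplectic_unit A : symplectic A -> A \in unitmx.
Proof.
move=> spA; suff: (Jform F *m A^T *m Jform F) *m A = 1%:M by case/mulmx1_unit.
by rewrite -!mulmxA (mulmxA A^T) spA JformK.
Qed.

Local Notation o0 := (@Ordinal 4 0 isT).
Local Notation o1 := (@Ordinal 4 1 isT).
Local Notation o2 := (@Ordinal 4 2 isT).
Local Notation o3 := (@Ordinal 4 3 isT).

Lemma ord4P (P : 'I_4 -> Prop) : P o0 -> P o1 -> P o2 -> P o3 -> forall i, P i.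
Proof.
move=> P0 P1 P2 P3 [[|[|[|[|i]]]] lti] //;
  [move: P0 | move: P1 | move: P2 | move: P3];
  by congr P; apply: val_inj.
Qed.

Lemma sum4E (f : 'I_4 -> F) : \sum_i f i = f o0 + f o1 + f o2 + f o3.
Proof.
rewrite !big_ord_recl big_ord0 addr0 !addrA.
by do !congr (_ + _); congr f; apply: val_inj.
Qed.

(** The form pairs the coordinate [k] with [rev_ord k]; the equation relates columns [i] and [j] of
    [A]. *)
Lemma symplecticE (A : 'M[F]_4) : symplectic A <-> forall i j,
  \sum_k A k i * A (rev_ord k) j = (j == rev_ord i)%:R.
Proof.
have JE i j : (A^T *m Jform F *m A) i j = \sum_k A k i * A (rev_ord k) j.
  have [r0 r1 r2 r3] : [/\ rev_ord o0 = o3, rev_ord o1 = o2, rev_ord o2 = o1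
    & rev_ord o3 = o0] by split; apply: val_inj.
  rewrite mxE !sum4E !mxE !sum4E !mxE /= r0 r1 r2 r3; ring.
have J_rev i j : Jform F i j = (j == rev_ord i)%:R.
  rewrite mxE -val_eqE.
  by elim/ord4P: i; elim/ord4P: j.
split=> [spA i j | spA]; first by rewrite -JE spA J_rev.
by apply/matrixP=> i j; rewrite JE spA J_rev.
Qed.

(** * Arithmetic in characteristic 2 *)

Hypothesis F2 : 2%:R = 0 :> F.
Lemma F4 : 4%:R = 0 :> F.
Proof. by rewrite (natrM _ 2 2) F2 mul0r. Qed.

Lemma F6 : 6%:R = 0 :> F.
Proof. by rewrite (natrM _ 2 3) F2 mul0r. Qed.

Lemma opp2 (x : F) : - x = x.
Proof. by apply/esym/eqP; rewrite -addr_eq0; apply/eqP; ring: F2. Qed.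

Lemma eq_add2 (x y : F) : x + y = 0 -> x = y.
Proof. by move=> xy0; apply/eqP; rewrite -[y]opp2 -addr_eq0 xy0. Qed.

(* [ring: F2] only cancels coefficients equal to 2, hence the even ones up to 6
   are listed, and both sides are added up to make all coefficients even. *)
Ltac ring2 := apply: eq_add2; ring: F6 F4 F2.

(** * Matrix identities for the Suzuki group *)

Variable n : nat.
Hypothesis card_F : #|F| = (2 ^ (2 * n + 1))%N.

Definition theta (x : F) : F := x ^+ sz_theta n.
(** This map is at once the square root of [theta] ([sqrt_thetaE]) and its inverse ([theta_sqrt]),
    because [theta] composed with itself is squaring. *)
Definition sqrt_theta (x : F) : F := x ^+ (2 ^ n).

Lemma pchar_F2 : 2%N \in [pchar F].
Proof. by rewrite inE /= F2 eqxx. Qed.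

Lemma thetaD x y : theta (x + y) = theta x + theta y.
Proof.
by rewrite /theta exprDn_pchar // pnatX (eq_pnat _ (pcharf_eq pchar_F2)) orbC.
Qed.

Lemma thetaM x y : theta (x * y) = theta x * theta y.
Proof. exact: exprMn. Qed.

Lemma thetaV x : theta x^-1 = (theta x)^-1.
Proof. exact: exprVn. Qed.

Lemma thetaX x k : theta (x ^+ k) = theta x ^+ k.
Proof. by rewrite /theta exprAC. Qed.

Lemma theta1 : theta 1 = 1.
Proof. exact: expr1n. Qed.

Lemma theta0 : theta 0 = 0.
Proof. by rewrite /theta expr0n /sz_theta expn_eq0. Qed.

Lemma theta_theta x : theta (theta x) = x ^+ 2.
Proof.
rewrite /theta -exprM /sz_theta -expnD.
have -> : (n.+1 + n.+1 = (2 * n + 1).+1)%N by lia.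
by rewrite expnSr -card_F exprM expf_card.
Qed.

Lemma sqrt_thetaE x : sqrt_theta x ^+ 2 = theta x.
Proof. by rewrite -exprM -expnSr. Qed.

Lemma theta_sqrt x : theta (sqrt_theta x) = x.
Proof.
rewrite /theta /sqrt_theta /sz_theta -exprM -expnD.
have -> : (n + n.+1 = 2 * n + 1)%N by lia.
by rewrite -card_F expf_card.
Qed.

Lemma sqr_inj (x y : F) : x ^+ 2 = y ^+ 2 -> x = y.
Proof.
move=> xy2; apply/eqP; rewrite -[y]opp2 -addr_eq0 -sqrf_eq0; apply/eqP.
by rewrite sqrrD xy2; ring2.
Qed.

Lemma theta_eq0 x : (theta x == 0) = (x == 0).
Proof. by rewrite expf_eq0 expn_gt0. Qed.

Lemma theta_inj : injective theta.
Proof. by move=> x y /(congr1 theta); rewrite !theta_theta; apply: sqr_inj. Qed.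

Lemma sqrt_theta1 : sqrt_theta 1 = 1.
Proof. exact: expr1n. Qed.

Lemma sqrt_theta_eq0 x : (sqrt_theta x == 0) = (x == 0).
Proof. by rewrite expf_eq0 expn_gt0. Qed.

Local Opaque theta sqrt_theta.

(** * The generating matrices of the Suzuki group and their products *)

Lemma sz_SE a b : sz_S n a b =
  mx4 1 0 0 0  a 1 0 0  b (theta a) 1 0
    (a ^+ 2 * theta a + a * b + theta b) (a * theta a + b) a 1.
Proof. by rewrite /sz_S !exprD expr1. Qed.

Lemma sz_ME l : sz_M n l =
  mx4 (l * sqrt_theta l) 0 0 0  0 (sqrt_theta l) 0 0
      0 0 (sqrt_theta l)^-1 0  0 0 0 (l * sqrt_theta l)^-1.
Proof. by rewrite /sz_M !exprD expr1. Qed.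

Lemma sz_S_symplectic (a b : F) : symplectic (sz_S n a b).
Proof. by rewrite /symplectic sz_SE trmx4 !mulmx4; congr mx4; ring2. Qed.

Lemma sz_M_symplectic (l : F) : l != 0 -> symplectic (sz_M n l).
Proof.
move=> nzl; have nzr : sqrt_theta l != 0 by rewrite sqrt_theta_eq0.
rewrite /symplectic sz_ME trmx4 !mulmx4; congr mx4; by field; rewrite ?nzl ?nzr.
Qed.

Lemma sz_W_symplectic : symplectic (sz_W F).
Proof. by rewrite /symplectic trmx4 !mulmx4; congr mx4; ring. Qed.

Lemma sz_SM (a b c d : F) :
  sz_S n a b *m sz_S n c d = sz_S n (a + c) (b + d + theta a * c).
Proof.
rewrite !sz_SE !thetaD thetaM theta_theta mulmx4; congr mx4; ring2.
Qed.

Lemma sz_MM (l m : F) : sz_M n l *m sz_M n m = sz_M n (l * m).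
Proof.
have rM : sqrt_theta (l * m) = sqrt_theta l * sqrt_theta m by apply: exprMn.
rewrite !sz_ME rM mulmx4; congr mx4; rewrite ?invfM; ring.
Qed.

Lemma sz_M1 : sz_M n (1 : F) = 1%:M.
Proof. by rewrite sz_ME sqrt_theta1 mulr1 invr1 mx4_1. Qed.

Lemma sz_S0 : sz_S n (0 : F) 0 = 1%:M.
Proof. by rewrite sz_SE theta0 mx4_1; congr mx4; ring. Qed.

Lemma sz_MS (l a b : F) : l != 0 ->
  sz_M n l *m sz_S n a b = sz_S n (a / l) (b / (l * theta l)) *m sz_M n l.
Proof.
move=> nzl; have nzr : sqrt_theta l != 0 by rewrite sqrt_theta_eq0.
rewrite !sz_SE sz_ME !thetaM !thetaV !thetaM theta_theta -(sqrt_thetaE l) !mulmx4.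
by congr mx4; field; rewrite ?nzl ?nzr.
Qed.

Lemma sz_WW : sz_W F *m sz_W F = 1%:M.
Proof. exact: JformK. Qed.

Lemma sz_WMW (l : F) : sz_W F *m sz_M n l *m sz_W F = sz_M n l^-1.
Proof.
have rV : sqrt_theta l^-1 = (sqrt_theta l)^-1 by apply: exprVn.
rewrite !sz_ME rV !mulmx4; congr mx4; rewrite ?invfM ?invrK; ring.
Qed.

(** The lower left entry of [sz_S n a b]. It serves as a denominator in the Bruhat factorization of
    W S W, hence the interest in its zeros. *)
Definition sz_norm (a b : F) := a ^+ 2 * theta a + a * b + theta b.

Lemma sz_norm_eq0 a b : sz_norm a b = 0 -> a = 0 /\ b = 0.
Proof.
move=> N0; have /(congr1 theta) := N0.
rewrite /sz_norm !thetaD !thetaM !theta_theta theta0 => T0.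
(* This product is [theta a * N + theta N] with [N] the norm; each factor being zero then forces
   [a = b = 0]. *)
have : b * (a * theta a + b) = 0.
  transitivity (theta a * sz_norm a b + (theta a ^+ 2 * a ^+ 2
      + theta a * theta b + b ^+ 2)); first by rewrite /sz_norm; ring2.
  rewrite N0 mulr0 add0r -[RHS]T0; ring.
move/eqP; rewrite mulf_eq0 => /orP[/eqP b0 | /eqP ab].
  move: N0; rewrite /sz_norm b0 mulr0 theta0 !addr0 => /eqP.
  by rewrite mulf_eq0 theta_eq0 sqrf_eq0 orbb => /eqP.
have bE : b = a * theta a by apply/esym/eqP; rewrite -[b]opp2 -addr_eq0 ab.
have tb0 : theta b = 0 by rewrite -[RHS]N0 /sz_norm bE; ring2.
have b0 : b = 0 by apply/eqP; rewrite -theta_eq0 tb0.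
move/eqP: bE; rewrite b0 eq_sym mulf_eq0 theta_eq0 orbb => /eqP.
by [].
Qed.

(* The factors are read off the first row and the last column of W S W. *)
Lemma sz_WSW (a b : F) (N := sz_norm a b) (T := theta (sz_norm a b))
    (c := (a * theta a + b) / N) : N != 0 ->
  sz_W F *m sz_S n a b *m sz_W F =
    sz_S n (b / N) (a / N) *m sz_M n (N ^+ 2 / T) *m sz_W F
      *m sz_S n c (a / N + c * theta c).
Proof.
move=> nzN; have nzT : T != 0 by rewrite theta_eq0.
(* The torus factor thus has diagonal [N, T / N, N / T, N^-1]. *)
have rE : sqrt_theta (N ^+ 2 / T) = T / N.
  apply: sqr_inj; rewrite sqrt_thetaE thetaM thetaV thetaX.
  by rewrite -[theta N]/T (theta_theta N : theta T = _) expr_div_n.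
have lrE : N ^+ 2 / T * (T / N) = N by field; rewrite nzN nzT.
have tcE : theta c = (theta a * a ^+ 2 + theta b) / T.
  by rewrite /c !thetaM thetaD thetaM thetaV theta_theta -/T.
(* The definitions of [N] and of [T = theta N], solved for [theta b] and [b ^+ 2], let these two be
   eliminated. *)
have NE : theta b = N + (a ^+ 2 * theta a + a * b) by rewrite /N /sz_norm; ring2.
have TE : b ^+ 2 = T + (theta a * N + theta a * a * b).
  by rewrite /T /N /sz_norm !thetaD !thetaM !theta_theta; ring2.
have ThN : theta N = T by [].
have cE : c = (a * theta a + b) * N^-1 by [].
have tu : theta N^-1 = T^-1 by rewrite thetaV.
have Nu : N * N^-1 = 1 by rewrite mulfV.
have Tw : T * T^-1 = 1 by rewrite mulfV.
rewrite sz_ME rE lrE invfM invrK.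
clearbody c T N; clear rE lrE ThN.
have {}tcE : theta c = (N + a * b) * T^-1 by rewrite tcE NE; congr (_ / _); ring2.
(* The inverses become variables [u] and [w] tied to [N] and [T] by [Nu] and [Tw]. Multiplying by
   powers of [N] and [T] ([cancel]) then leaves polynomial identities. *)
move: N^-1 T^-1 tu cE tcE Nu Tw => u w tu cE tcE Nu Tw.
have cancel i j x y : x * (N ^+ i * T ^+ j) = y * (N ^+ i * T ^+ j) -> x = y.
  by apply: mulIf; rewrite mulf_neq0 ?expf_neq0.
have S'E : sz_S n (b * u) (a * u) =
  mx4 1 0 0 0  (b * u) 1 0 0  (a * u) (theta b * w) 1 0  u (c * N * w) (b * u) 1.
  rewrite sz_SE !thetaM tu NE cE; move: (theta a) TE => A TE.
  have b3 : b ^+ 3 = b * T + A * N * b + A * a * b ^+ 2.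
    by rewrite (exprS b 2) {1}TE; ring.
  congr mx4; clear -F2 cancel Nu Tw TE b3.
    apply: (cancel 2 1); apply: eq_add2; ring: Nu Tw b3 TE F6 F4 F2.
  apply: (cancel 1 1); apply: eq_add2; ring: Nu Tw b3 TE F6 F4 F2.
have S''E : sz_S n c (a * u + c * theta c) =
  mx4 1 0 0 0  c 1 0 0  (b * w) (theta c) 1 0  u (a * u) c 1.
  rewrite sz_SE !thetaD !thetaM (theta_theta c) tu tcE.
  move: (theta a) cE TE => A cE TE.
  have b3 : b ^+ 3 = b * T + A * N * b + A * a * b ^+ 2.
    by rewrite (exprS b 2) {1}TE; ring.
  congr mx4; clear -F2 cancel Nu Tw TE b3 cE.
  - rewrite cE; apply: (cancel 1 1); apply: eq_add2; ring: Nu Tw b3 TE F6 F4 F2.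
  - transitivity (c * a * u + A * w + (N + a * b) * w * c ^+ 2); first ring2.
    rewrite cE; apply: (cancel 2 1); apply: eq_add2; ring: Nu Tw b3 TE F6 F4 F2.
  ring2.
rewrite {}S'E {}S''E sz_SE tcE !mulmx4 cE NE.
move: (theta a) TE => A TE.
have b3 : b ^+ 3 = b * T + A * N * b + A * a * b ^+ 2 by rewrite (exprS b 2) {1}TE; ring.
congr mx4; clear -F2 cancel Nu Tw TE b3.
all: by apply: (cancel 3 2); apply: eq_add2; ring: Nu Tw b3 TE F6 F4 F2.
Qed.
(** * Bruhat decomposition of Sp4 *)

(* The groups are accessed through an abstract faithful representation [mx_of]:
   unification on concrete elements of {'GL_4[F]} unfolds far too much. *)
Variables (gT : finGroupType) (G : {group gT}).
Variables (mx_of : gT -> 'M[F]_4) (of_mx : 'M[F]_4 -> gT).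
Hypothesis mx_of_inj : injective mx_of.
Hypothesis mx_of1 : mx_of 1%g = 1%:M.
Hypothesis mx_ofM : forall g h, mx_of (g * h)%g = mx_of g *m mx_of h.
Hypothesis of_mxK : forall A, A \in unitmx -> mx_of (of_mx A) = A.
Hypothesis mem_G : forall g, (g \in G) = ((mx_of g)^T *m Jform F *m mx_of g == Jform F).

Lemma symplectic_mx_of g : g \in G -> symplectic (mx_of g).
Proof. by rewrite mem_G => /eqP. Qed.

Lemma symplectic_of_mx A : symplectic A -> of_mx A \in G.
Proof. by move=> spA; rewrite mem_G of_mxK ?symplectic_unit // spA. Qed.

(** Triangular means lower triangular, and matrices act on columns, so this is the stabilizer in [G]
    of the flag [<e_3> < <e_3, e_2>]. *)
Definition borel_set : {set gT} :=
  [set g in G | is_trig_mx (mx_of g)].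

Lemma borel_group_set : group_set borel_set.
Proof.
apply/andP; split.
  by rewrite inE group1; apply/is_trig_mxP=> i j ltij; rewrite mx_of1 mxE -val_eqE ltn_eqF.
apply/subsetP=> _ /imset2P[g h Bg Bh ->]; move: Bg Bh.
rewrite ![_ \in borel_set]inE => /andP[Gg /is_trig_mxP Tg] /andP[Gh /is_trig_mxP Th].
rewrite groupM //; apply/is_trig_mxP=> i j ltij; rewrite mx_ofM mxE big1 // => k _.
have [ltik | leki] := ltnP i k; first by rewrite Tg ?mul0r.
by rewrite [mx_of h _ _]Th ?mulr0 // (leq_ltn_trans leki).
Qed.
Canonical borel : {group gT} := Group borel_group_set.

Lemma borel_sub : borel \subset G.
Proof. by apply/subsetP=> g; rewrite inE => /andP[]. Qed.

(* The permutation of the coordinates sending the reference flag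
   <e_3> < <e_3, e_2> to <e_i> < <e_i, e_j>, commuting with rev_ord. *)
Definition weyl_perm (ij : 'I_4 * 'I_4) (k : 'I_4) : 'I_4 :=
  nth ij.1 [:: rev_ord ij.1; rev_ord ij.2; ij.2; ij.1] k.

(** The pairs for which [e_i] and [e_j] span a totally isotropic plane. *)
Definition weyl_index (ij : 'I_4 * 'I_4) :=
  (ij.2 != ij.1) && (ij.2 != rev_ord ij.1).

Definition weyl (ij : 'I_4 * 'I_4) : gT :=
  of_mx (\matrix_(r, c) (r == weyl_perm ij c)%:R).

Lemma weyl_perm_inj ij : weyl_index ij -> injective (weyl_perm ij).
Proof.
case: ij => i j; rewrite /weyl_index /weyl_perm /= => /andP[].
rewrite -!val_eqE => ji jri k l /(congr1 val); move: ji jri.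
by elim/ord4P: i; elim/ord4P: j => //=; elim/ord4P: k; elim/ord4P: l.
Qed.

Lemma weyl_perm_rev ij k : weyl_perm ij (rev_ord k) = rev_ord (weyl_perm ij k).
Proof.
case: ij => i j; apply: val_inj; rewrite /weyl_perm /=.
by elim/ord4P: k; elim/ord4P: i; elim/ord4P: j.
Qed.

Lemma weyl_symplectic ij : weyl_index ij ->
  symplectic (\matrix_(r, c) (r == weyl_perm ij c)%:R).
Proof.
move=> Wij; apply/symplecticE=> i j; rewrite (bigD1 (weyl_perm ij i)) //= big1.
  rewrite !mxE eqxx mul1r addr0 -weyl_perm_rev (inj_eq (weyl_perm_inj Wij)).
  by rewrite eq_sym.
by move=> k /negPf nk; rewrite mxE nk mul0r.
Qed.

Lemma weyl_in ij : weyl_index ij -> weyl ij \in G.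
Proof. by move=> Wij; apply: symplectic_of_mx; apply: weyl_symplectic. Qed.

Lemma weyl_mulE ij (g : gT) r c : weyl_index ij ->
  mx_of ((weyl ij)^-1 * g)%g r c = mx_of g (weyl_perm ij r) c.
Proof.
move=> Wij; rewrite -[g in RHS](mulKVg (weyl ij)) [in RHS]mx_ofM.
rewrite of_mxK ?symplectic_unit //; last exact: weyl_symplectic.
rewrite [RHS]mxE (bigD1 r) //= mxE eqxx mul1r big1 ?addr0 // => k.
by rewrite mxE (inj_eq (weyl_perm_inj Wij)) eq_sym => /negPf->; rewrite mul0r.
Qed.

Lemma card_weyl_index : #|[pred ij | weyl_index ij]| = 8%N.
Proof.
rewrite -sum1_card (eq_bigl (fun ij => weyl_index (ij.1, ij.2))); last by case.
rewrite -(pair_big_dep xpredT (fun i j => weyl_index (i, j)) (fun _ _ => 1%N)) /=.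
rewrite !big_ord_recl big_ord0.
by do 4!rewrite big_mkcond !big_ord_recl big_ord0 /weyl_index -!val_eqE /=.
Qed.

(** For invertible [A], its last two columns say that [A] sends the reference flag to the coordinate
    flag [<e_i> < <e_i, e_j>]. *)
Definition flag_at (ij : 'I_4 * 'I_4) (A : 'M[F]_4) :=
  (forall r, r != ij.1 -> A r o3 = 0) /\
  (forall r, r != ij.1 -> r != ij.2 -> A r o2 = 0).

Lemma symplectic_sum_supp (A : 'M[F]_4) i j k : symplectic A ->
    (forall r, r != k -> A r j = 0) ->
  A (rev_ord k) i * A k j = (j == rev_ord i)%:R.
Proof.
move=> /symplecticE spA Aj; rewrite -spA (bigD1 (rev_ord k)) //= rev_ordK.
rewrite big1 ?addr0 // => r nrk; rewrite [X in _ * X]Aj ?mulr0 //.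
by rewrite -(inj_eq rev_ord_inj) rev_ordK.
Qed.

(** Once the flag is moved back to the reference one, the only entry above the diagonal left to kill
    is [(0, 1)]; it is zero because column 1 is orthogonal to column 3, a multiple of [e_3]. *)
Lemma flag_at_weyl ij (g : gT) : weyl_index ij -> g \in G ->
  flag_at ij (mx_of g) -> ((weyl ij)^-1 * g)%g \in borel.
Proof.
move=> Wij Gg [g3 g2].
have := groupM (groupVr (weyl_in Wij)) Gg; set h := (_ * g)%g => Gh.
have h3 r : r != o3 -> mx_of h r o3 = 0.
  rewrite weyl_mulE // => nr; apply: g3.
  by rewrite -[ij.1]/(weyl_perm ij o3) (inj_eq (weyl_perm_inj Wij)).
have h2 r : r != o3 -> r != o2 -> mx_of h r o2 = 0.
  rewrite weyl_mulE // => nr3 nr2; apply: g2.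
    by rewrite -[ij.1]/(weyl_perm ij o3) (inj_eq (weyl_perm_inj Wij)).
  by rewrite -[ij.2]/(weyl_perm ij o2) (inj_eq (weyl_perm_inj Wij)).
have spf i := symplectic_sum_supp i (symplectic_mx_of Gh) h3.
have nz_h33 : mx_of h o3 o3 != 0.
  apply/eqP=> h33; have /eqP := spf o0.
  by rewrite h33 mulr0 -[o3 == _]/true eq_sym oner_eq0.
rewrite inE Gh; apply/is_trig_mxP=> i j.
have h01 : mx_of h o0 o1 = 0.
  have /eqP := spf o1; rewrite mulf_eq0 (negPf nz_h33) orbF => /eqP.
  by congr (_ = _); congr (mx_of h _ _); apply: val_inj.
by elim/ord4P: i; elim/ord4P: j => // _; rewrite ?h3 ?h2 ?h01.
Qed.

(** Column 3 is a multiple of [e_i], and column 2 is orthogonal to it, which kills the entry at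
    [rev_ord i]. Were column 2 also a multiple of [e_i], it would be orthogonal to column 1, whereas
    these two pair to 1. *)
Lemma flag_at_exists i (g : gT) : g \in G ->
    (forall r, r != i -> mx_of g r o3 = 0) ->
  [/\ mx_of g i o3 != 0, mx_of g (rev_ord i) o2 = 0
    & exists2 j, weyl_index (i, j) & mx_of g j o2 != 0].
Proof.
move=> Gg g3; have spg := symplectic_mx_of Gg.
have spf k := symplectic_sum_supp k spg g3.
have nz_gi : mx_of g i o3 != 0.
  apply/eqP=> gi; have /eqP := spf o0.
  by rewrite gi mulr0 -[o3 == _]/true eq_sym oner_eq0.
have g_rev k : k != o0 -> mx_of g (rev_ord i) k = 0.
  move=> nk; have : mx_of g (rev_ord i) k * mx_of g i o3 == 0.
    rewrite spf; case: (o3 =P rev_ord k) => // o3E; case/negP: nk.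
    by apply/eqP/rev_ord_inj; rewrite -o3E; apply: val_inj.
  by rewrite mulf_eq0 (negPf nz_gi) orbF => /eqP.
split=> //; first exact: g_rev.
apply/exists_inP; apply: contraT; rewrite negb_exists_in => /forall_inP g2.
have {}g2 r : r != i -> mx_of g r o2 = 0.
  move=> nri; have [-> | nrr] := eqVneq r (rev_ord i); first exact: g_rev.
  by apply/eqP; rewrite -[_ == _]negbK; apply: g2; rewrite /weyl_index nri.
have := symplectic_sum_supp o1 spg g2; rewrite g_rev // mul0r => /esym/eqP.
by rewrite oner_eq0.
Qed.

(** * Moving isotropic flags to coordinate flags by the Borel subgroup *)

Definition mx_heis (x y z : F) : 'M[F]_4 := mx4 1 0 0 0  x 1 0 0  y 0 1 0  z y x 1.
(** While [mx_heis] describes the unipotent radical of the stabilizer of [<e_3>], this is a root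
    subgroup of the SL2 factor acting on [<e_1, e_2>]. *)
Definition mx_sl2 (t : F) : 'M[F]_4 := mx4 1 0 0 0  0 1 0 0  0 t 1 0  0 0 0 1.

Lemma borel_of_mx A : symplectic A -> is_trig_mx A -> of_mx A \in borel.
Proof.
by move=> spA tA; rewrite inE symplectic_of_mx ?of_mxK ?symplectic_unit.
Qed.

Lemma heis_symplectic x y z : symplectic (mx_heis x y z).
Proof. by rewrite /symplectic trmx4 !mulmx4; congr mx4; ring2. Qed.

Lemma sl2_symplectic t : symplectic (mx_sl2 t).
Proof. by rewrite /symplectic trmx4 !mulmx4; congr mx4; ring2. Qed.

Lemma mx4_trig (a00 a10 a11 a20 a21 a22 a30 a31 a32 a33 : F) :
  is_trig_mx (mx4 a00 0 0 0 a10 a11 0 0 a20 a21 a22 0 a30 a31 a32 a33).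
Proof.
by apply/is_trig_mxP=> i j; elim/ord4P: i; elim/ord4P: j => //; rewrite mxE.
Qed.

Lemma heis_borel x y z : of_mx (mx_heis x y z) \in borel.
Proof. exact: borel_of_mx (heis_symplectic _ _ _) (mx4_trig _ _ _ _ _ _ _ _ _ _). Qed.

Lemma sl2_borel t : of_mx (mx_sl2 t) \in borel.
Proof. exact: borel_of_mx (sl2_symplectic _) (mx4_trig _ _ _ _ _ _ _ _ _ _). Qed.

Lemma heis_mulE x y z g r c : mx_of (of_mx (mx_heis x y z) * g)%g r c =
  \sum_k mx_heis x y z r k * mx_of g k c.
Proof. by rewrite mx_ofM mxE of_mxK //; apply/symplectic_unit/heis_symplectic. Qed.

Lemma sl2_mulE t g r c : mx_of (of_mx (mx_sl2 t) * g)%g r c =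
  \sum_k mx_sl2 t r k * mx_of g k c.
Proof. by rewrite mx_ofM mxE of_mxK //; apply/symplectic_unit/sl2_symplectic. Qed.

(** Gaussian elimination on the last column: its first nonzero entry is the pivot and the entries
    below are cleared by lower triangular symplectic matrices. *)
Lemma borel_move_point g : exists2 b, b \in borel &
  exists i, forall r, r != i -> mx_of (b * g)%g r o3 = 0.
Proof.
have [v0 | nz0] := eqVneq (mx_of g o0 o3) 0; last first.
  set v := (fun r => mx_of g r o3); rewrite -/(v o0) in nz0.
  pose x := - v o1 / v o0; pose y := - v o2 / v o0.
  exists (of_mx (mx_heis x y (- (y * v o1 + x * v o2 + v o3) / v o0))).
    exact: heis_borel.
  exists o0; elim/ord4P => // _; rewrite heis_mulE sum4E !mxE /= -!/(v _);
  by rewrite /x /y; field.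
have [v1 | nz1] := eqVneq (mx_of g o1 o3) 0; last first.
  set v := (fun r => mx_of g r o3); rewrite -/(v o1) in nz1.
  rewrite -/(v o0) in v0.
  pose y := - v o3 / v o1; pose t := - v o2 / v o1.
  exists (of_mx (mx_heis 0 y 0) * of_mx (mx_sl2 t))%g.
    by rewrite groupM ?heis_borel ?sl2_borel.
  exists o1; elim/ord4P => // _; rewrite -mulgA heis_mulE sum4E !sl2_mulE;
  by rewrite !sum4E !mxE /= -!/(v _) v0 /y /t; field.
have [v2 | nz2] := eqVneq (mx_of g o2 o3) 0; last first.
  exists (of_mx (mx_heis (- mx_of g o3 o3 / mx_of g o2 o3) 0 0)).
    exact: heis_borel.
  exists o2; elim/ord4P => // _; rewrite heis_mulE sum4E !mxE /= v0 v1;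
  by field.
by exists 1%g; rewrite ?group1 //; exists o3; elim/ord4P; rewrite // mul1g.
Qed.

(** Modulo [e_i], column 2 lies in a plane spanned by two coordinate vectors. One root element
    fixing [e_i] clears the lower coordinate by the upper one, unless the upper one is already
    zero. *)
Lemma borel_move_line i g : g \in G -> (forall r, r != i -> mx_of g r o3 = 0) ->
  exists2 b, b \in borel &
    exists2 j, weyl_index (i, j) & flag_at (i, j) (mx_of (b * g)%g).
Proof.
move=> Gg g3; have [_ grev _] := flag_at_exists Gg g3.
elim/ord4P: i g3 grev => g3 grev.
- have {}grev : mx_of g o3 o2 = 0 by rewrite -grev; congr (mx_of g _ _); apply: val_inj.
  have [w0 | nz0] := eqVneq (mx_of g o1 o2) 0.
    exists 1%g; rewrite ?group1 //; exists o2 => //; rewrite mul1g; split=> //.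
    by elim/ord4P.
  exists (of_mx (mx_sl2 (- mx_of g o2 o2 / mx_of g o1 o2))); first exact: sl2_borel.
  exists o1 => //; split; elim/ord4P => //= _; try move=> _;
  by rewrite sl2_mulE sum4E !mxE /= ?(g3 o1) // ?(g3 o2) // ?(g3 o3) // ?grev; field.
- have {}grev : mx_of g o2 o2 = 0 by rewrite -grev; congr (mx_of g _ _); apply: val_inj.
  have [w0 | nz0] := eqVneq (mx_of g o0 o2) 0.
    exists 1%g; rewrite ?group1 //; exists o3 => //; rewrite mul1g; split=> //.
    by elim/ord4P.
  exists (of_mx (mx_heis 0 0 (- mx_of g o3 o2 / mx_of g o0 o2))); first exact: heis_borel.
  exists o0 => //; split; elim/ord4P => //= _; try move=> _;
  by rewrite heis_mulE sum4E !mxE /= ?(g3 o0) // ?(g3 o2) // ?(g3 o3) // ?grev; field.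
- have {}grev : mx_of g o1 o2 = 0 by rewrite -grev; congr (mx_of g _ _); apply: val_inj.
  have [w0 | nz0] := eqVneq (mx_of g o0 o2) 0.
    exists 1%g; rewrite ?group1 //; exists o3 => //; rewrite mul1g; split=> //.
    by elim/ord4P.
  exists (of_mx (mx_heis 0 0 (- mx_of g o3 o2 / mx_of g o0 o2))); first exact: heis_borel.
  exists o0 => //; split; elim/ord4P => //= _; try move=> _;
  by rewrite heis_mulE sum4E !mxE /= ?(g3 o0) // ?(g3 o1) // ?(g3 o3) // ?grev; field.
- have {}grev : mx_of g o0 o2 = 0 by rewrite -grev; congr (mx_of g _ _); apply: val_inj.
  have [w0 | nz0] := eqVneq (mx_of g o1 o2) 0.
    exists 1%g; rewrite ?group1 //; exists o2 => //; rewrite mul1g; split=> //.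
    by elim/ord4P.
  exists (of_mx (mx_sl2 (- mx_of g o2 o2 / mx_of g o1 o2))); first exact: sl2_borel.
  exists o1 => //; split; elim/ord4P => //= _; try move=> _;
  by rewrite sl2_mulE sum4E !mxE /= ?(g3 o0) // ?(g3 o1) // ?(g3 o2) // ?grev; field.
Qed.

Lemma Sp4_bruhat g : g \in G ->
  exists2 ij, weyl_index ij & g \in (borel :* weyl ij * borel)%g.
Proof.
move=> Gg; have [b1 Bb1 [i g3]] := borel_move_point g.
have sBG := subsetP borel_sub.
have [b2 Bb2 [j Wij fl]] := borel_move_line (groupM (sBG _ Bb1) Gg) g3.
exists (i, j) => //.
have Bb := flag_at_weyl Wij (groupM (sBG _ Bb2) (groupM (sBG _ Bb1) Gg)) fl.
rewrite -[g](mulKg b1) -[(b1 * g)%g](mulKg b2) mulgA.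
rewrite -[(b2 * (b1 * g))%g](mulKVg (weyl (i, j))) mulgA mem_mulg //.
by rewrite mem_rcoset mulgK groupM ?groupV.
Qed.

(** The hypothesis says that [m] fixes the flag of [g]. Column 3 is then an eigenvector of [m] and
    column 2 an eigenvector modulo column 3; distinct eigenvalues make both coordinate vectors in
    that sense. *)
Lemma conj_diag_borel m g (d : 'I_4 -> F) : g \in G -> injective d ->
    (forall r c, mx_of m r c = (d r) *+ (r == c)) -> (m ^ g)%g \in borel ->
  exists2 ij, weyl_index ij & ((weyl ij)^-1 * g)%g \in borel.
Proof.
move=> Gg d_inj mE; rewrite inE => /andP[_ /is_trig_mxP trig].
have eqE r c : d r * mx_of g r c = \sum_k mx_of g r k * mx_of (m ^ g)%g k c.
  have <- : mx_of (m * g)%g r c = d r * mx_of g r c.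
    rewrite mx_ofM mxE (bigD1 r) //= mE eqxx big1 ?addr0 // => k.
    by rewrite mE eq_sym => /negPf->; rewrite mul0r.
  by rewrite conjgC mx_ofM mxE.
have eq3 r : mx_of g r o3 != 0 -> d r = mx_of (m ^ g)%g o3 o3.
  move=> nz; apply: (mulIf nz); rewrite eqE sum4E (trig o0 o3) // (trig o1 o3) //.
  by rewrite (trig o2 o3) //; ring.
have [i nz_i] : exists i, mx_of g i o3 != 0.
  apply/existsP; apply: contraT; rewrite negb_exists => /forallP g3.
  have {}g3 r : mx_of g r o3 = 0 by apply/eqP; have := g3 r; rewrite negbK.
  have [nz _ _] := flag_at_exists Gg (fun r (_ : r != o0) => g3 r).
  by rewrite g3 eqxx in nz.
have g3 r : r != i -> mx_of g r o3 = 0.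
  move=> nri; apply/eqP; apply: contraNT nri => /eq3 dr.
  by apply/eqP/d_inj; rewrite dr eq3.
have [_ _ [j Wij nz_j]] := flag_at_exists Gg g3.
have eq2 r : r != i -> mx_of g r o2 != 0 -> d r = mx_of (m ^ g)%g o2 o2.
  move=> nri nz; apply: (mulIf nz); rewrite eqE sum4E (trig o0 o2) // (trig o1 o2) //.
  by rewrite (g3 r nri); ring.
exists (i, j) => //; apply: flag_at_weyl => //; split=> //= r nri nrj.
apply/eqP; apply: contraNT nrj => /(eq2 _ nri) dr.
by apply/eqP/d_inj; rewrite dr eq2 //; case/andP: Wij.
Qed.

(* Representatives of the q ^ 4 cosets of the Borel subgroup in the big cell. *)
Definition mx_cell (p : F * F * F * F) : 'M[F]_4 :=
  let: (x, y, z, t) := p in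
  mx4 0 0 0 1  0 0 1 x  0 1 t y  1 x (y + t * x) z.

Lemma cell_symplectic p : symplectic (mx_cell p).
Proof.
case: p => [[[x y] z] t].
by rewrite /symplectic trmx4 !mulmx4; congr mx4; ring2.
Qed.

(* The coset of 1 lies outside the big cell; this strictness is needed for
   q = 8. *)
Lemma card_Sp4_gt : (#|F| ^ 4 * #|borel| < #|G|)%N.
Proof.
pose f (o : option (F * F * F * F)) : gT :=
  if o is Some p then of_mx (mx_cell p) else 1%g.
have fE p : mx_of (f (Some p)) = mx_cell p.
  by rewrite of_mxK // symplectic_unit //; apply: cell_symplectic.
have fG o : f o \in G.
  by case: o => [p|]; rewrite ?group1 // symplectic_of_mx //; apply: cell_symplectic.
have f_inj : injective (fun o => f o *: borel)%g.
  move=> o o' /lcoset_eqP; rewrite mem_lcoset inE => /andP[_ /is_trig_mxP trig].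
  set b := (_ * _)%g in trig.
  have eqE r c : mx_of (f o) r c = \sum_k mx_of (f o') r k * mx_of b k c.
    by rewrite -[f o](mulKVg (f o')) mx_ofM mxE.
  (* Only the last two columns are compared: they determine the four parameters, and the entry
     [(0, 3)] separates the cell from 1. *)
  have t3 : [/\ mx_of b o0 o3 = 0, mx_of b o1 o3 = 0 & mx_of b o2 o3 = 0].
    by split; apply: trig.
  have t2 : mx_of b o0 o2 = 0 /\ mx_of b o1 o2 = 0 by split; apply: trig.
  case: t3 t2 => [b03 b13 b23] [b02 b12].
  have e3 r : mx_of (f o) r o3 = mx_of (f o') r o3 * mx_of b o3 o3.
    by rewrite eqE sum4E b03 b13 b23; ring.
  have e2 r : mx_of (f o) r o2
      = mx_of (f o') r o2 * mx_of b o2 o2 + mx_of (f o') r o3 * mx_of b o3 o2.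
    by rewrite eqE sum4E b02 b12; ring.
  move: {trig eqE b03 b13 b23 b02 b12 b}(mx_of b) e3 e2 => b.
  case: o o' => [p|] [p'|] e3 e2 //.
  - move: (e3 o0) (e3 o1) (e3 o2) (e3 o3) (e2 o0) (e2 o1) (e2 o2).
    rewrite !fE; case: p p' {e3 e2} => [[[x y] z] t] [[[x' y'] z'] t'].
    rewrite !mxE /= !mul1r => <-; rewrite !mulr1 => -> -> ->.
    by rewrite mul0r add0r => <-; rewrite !mulr0 !addr0 => <-; rewrite mulr1 => ->.
  - move: (e3 o0); rewrite fE mx_of1; case: p {e3 e2} => [[[x y] z] t].
    by rewrite !mxE /= mul0r => /eqP; rewrite oner_eq0.
  move: (e3 o0) (e3 o3); rewrite fE mx_of1; case: p' {e3 e2} => [[[x y] z] t].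
  by rewrite !mxE /= mul1r => <-; rewrite mulr0 => /eqP; rewrite oner_eq0.
rewrite -(Lagrange borel_sub) mulnC ltn_pmul2l ?cardG_gt0 //.
rewrite -card_lcosets (_ : (#|F| ^ 4).+1 = #|{: option (F * F * F * F)}|)%N.
  rewrite -cardsT -(card_imset _ f_inj); apply: subset_leq_card.
  by apply/subsetP=> _ /imsetP[o _ ->]; apply/lcosetsP; exists (f o).
by rewrite card_option !card_prod !expnS expn0 muln1 !mulnA.
Qed.

(** * The Suzuki group *)

Hypothesis n_gt0 : (0 < n)%N.
Variable H : {group gT}.
Hypothesis H_gen : H = <<[set g |
     [|| [exists a : F, exists b : F, mx_of g == sz_S n a b],
         [exists l : F, (l != 0) && (mx_of g == sz_M n l)]
       | mx_of g == sz_W F]]>>%g :> {set gT}.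

Definition gS (a b : F) : gT := of_mx (sz_S n a b).
Definition gM (l : F) : gT := of_mx (sz_M n l).
Definition gW : gT := of_mx (sz_W F).

Arguments gS (a b)%_R.
Arguments gM l%_R.

Lemma gSE a b : mx_of (gS a b) = sz_S n a b.
Proof. by rewrite of_mxK // symplectic_unit //; apply: sz_S_symplectic. Qed.

Lemma gME l : l != 0 -> mx_of (gM l) = sz_M n l.
Proof. by move=> nzl; rewrite of_mxK // symplectic_unit //; apply: sz_M_symplectic. Qed.

Lemma gWE : mx_of gW = sz_W F.
Proof. by rewrite of_mxK // symplectic_unit //; apply: sz_W_symplectic. Qed.

Lemma gS_H a b : gS a b \in H.
Proof.
rewrite H_gen mem_gen // inE; apply/or3P/Or31.
by apply/existsP; exists a; apply/existsP; exists b; rewrite gSE.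
Qed.

Lemma gM_H l : l != 0 -> gM l \in H.
Proof.
move=> nzl; rewrite H_gen mem_gen // inE; apply/or3P/Or32.
by apply/existsP; exists l; rewrite nzl gME /=.
Qed.

Lemma Sz_sub_Sp4 : H \subset G.
Proof.
rewrite H_gen gen_subG; apply/subsetP=> g; rewrite inE mem_G => gen_g.
apply/eqP; case/or3P: gen_g => [/existsP[a /existsP[b /eqP->]] | | /eqP->].
- exact: sz_S_symplectic.
- by case/existsP=> l /andP[nzl /eqP->]; apply: sz_M_symplectic.
exact: sz_W_symplectic.
Qed.

Definition sz_borel_set : {set gT} := [set g |
  [exists a, exists b, exists l, (l != 0) && (mx_of g == sz_S n a b *m sz_M n l)]].

Lemma sz_borelP g :
  reflect (exists a b, exists2 l, l != 0 & g = (gS a b * gM l)%g) (g \in sz_borel_set).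
Proof.
rewrite inE; apply: (iffP existsP) => [[a /existsP[b /existsP[l]]] | [a [b [l nzl ->]]]].
  case/andP=> nzl /eqP gE; exists a, b, l => //; apply: mx_of_inj.
  by rewrite gE mx_ofM gSE gME.
exists a; apply/existsP; exists b; apply/existsP; exists l.
by rewrite nzl mx_ofM gSE gME /=.
Qed.

Lemma gMM l m : l != 0 -> m != 0 -> (gM l * gM m)%g = gM (l * m).
Proof.
move=> nzl nzm; apply: mx_of_inj; rewrite mx_ofM !gME ?mulf_neq0 //.
exact: sz_MM.
Qed.

Lemma gSS a b c d : (gS a b * gS c d)%g = gS (a + c) (b + d + theta a * c).
Proof. by apply: mx_of_inj; rewrite mx_ofM !gSE sz_SM. Qed.

Lemma gMS l a b : l != 0 -> (gM l * gS a b)%g = (gS (a / l) (b / (l * theta l)) * gM l)%g.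
Proof. by move=> nzl; apply: mx_of_inj; rewrite !mx_ofM !gSE gME // sz_MS. Qed.

Lemma gM1 : gM 1 = 1%g.
Proof. by apply: mx_of_inj; rewrite gME ?oner_eq0 // sz_M1 mx_of1. Qed.

Lemma gS0 : gS 0 0 = 1%g.
Proof. by apply: mx_of_inj; rewrite gSE sz_S0 mx_of1. Qed.

Lemma gMV l : l != 0 -> (gM l)^-1%g = gM l^-1.
Proof.
move=> nzl; apply/eqP; rewrite eq_invg_mul gMM ?invr_eq0 // mulfV //.
by rewrite gM1.
Qed.

Lemma gWW : (gW * gW)%g = 1%g.
Proof. by apply: mx_of_inj; rewrite mx_ofM gWE sz_WW mx_of1. Qed.

Lemma gM_conjW l : l != 0 -> (gM l ^ gW)%g = gM l^-1.
Proof.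
move=> nzl; have WV : (gW^-1 = gW)%g by apply/eqP; rewrite eq_invg_mul gWW.
rewrite conjgE WV; apply: mx_of_inj.
by rewrite !mx_ofM gWE !gME ?invr_eq0 // mulmxA sz_WMW.
Qed.

Lemma sz_borel_group_set : group_set sz_borel_set.
Proof.
apply/andP; split.
  by apply/sz_borelP; exists 0, 0, 1; rewrite ?oner_eq0 // gS0 gM1 mulg1.
apply/subsetP=> _ /imset2P[x y Kx Ky ->]; apply/sz_borelP.
have [a [b [l nzl ->]]] := sz_borelP _ Kx; have [c [d [m nzm ->]]] := sz_borelP _ Ky.
rewrite mulgA -(mulgA (gS a b)) gMS // mulgA gSS -mulgA gMM //.
by do 3!eexists; last reflexivity; rewrite mulf_neq0.
Qed.
Canonical sz_borel : {group gT} := Group sz_borel_group_set.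

Lemma gS_borel a b : gS a b \in sz_borel.
Proof. by apply/sz_borelP; exists a, b, 1; rewrite ?oner_eq0 // gM1 mulg1. Qed.

Lemma gM_borel l : l != 0 -> gM l \in sz_borel.
Proof. by move=> nzl; apply/sz_borelP; exists 0, 0, l; rewrite // gS0 mul1g. Qed.

Lemma sz_borel_sub : sz_borel \subset H.
Proof.
apply/subsetP=> _ /sz_borelP[a [b [l nzl ->]]].
by rewrite groupM ?gS_H ?gM_H.
Qed.

Lemma card_sz_borel : (#|sz_borel| <= #|F| ^ 2 * #|F|.-1)%N.
Proof.
have sub : sz_borel \subset [set (gS p.1.1 p.1.2 * gM p.2)%g
    | p in setX [set: F * F] [set~ (0 : F)]].
  apply/subsetP=> _ /sz_borelP[a [b [l nzl ->]]]; apply/imsetP.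
  by exists (a, b, l); rewrite // !inE.
apply: leq_trans (subset_leq_card sub) _; apply: leq_trans (leq_imset_card _ _) _.
by rewrite cardsX cardsT cardsC1 card_prod mulnn.
Qed.

Lemma gWSW a b : (a, b) != (0, 0) ->
  (gW * gS a b * gW)%g \in (sz_borel :* gW * sz_borel)%g.
Proof.
move=> nz_ab; have nzN : sz_norm a b != 0.
  by apply: contra nz_ab => /eqP/sz_norm_eq0[-> ->].
have nzT : theta (sz_norm a b) != 0 by rewrite theta_eq0.
set N := sz_norm a b in nzN nzT *; pose c := (a * theta a + b) / N.
have nzl : N ^+ 2 / theta N != 0 by rewrite mulf_neq0 ?expf_neq0 ?invr_eq0.
suff -> : (gW * gS a b * gW)%g =
    (gS (b / N) (a / N) * gM (N ^+ 2 / theta N) * gW * gS c (a / N + c * theta c))%g.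
  by rewrite mem_mulg ?gS_borel // mem_rcoset mulgK groupM ?gS_borel ?gM_borel.
by apply: mx_of_inj; rewrite !mx_ofM !gSE gWE gME // sz_WSW.
Qed.

(** The elements stabilizing the union of [K] and [K W K] by right multiplication form a group. It
    contains all generators of [H], [W] being handled by [gWSW], and the union contains 1. *)
Lemma Sz_bruhat h : h \in H ->
  (h \in sz_borel) || (h \in (sz_borel :* gW * sz_borel)%g).
Proof.
set K := sz_borel; set C := (K :* gW * K)%g.
have C_K x k : x \in C -> k \in K -> (x * k)%g \in C.
  by case/mulsgP=> y z Ky Kz -> Kk; rewrite -mulgA mem_mulg ?groupM.
have K_C x k : x \in C -> k \in K -> (k * x)%g \in C.
  case/mulsgP=> _ z /rcosetP[y Ky ->] Kz -> Kk.
  by rewrite !mulgA mem_mulg // mem_rcoset mulgK groupM.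
have C_W : gW \in C by rewrite -[gW]mulg1 mem_mulg ?rcoset_refl.
pose D := (sz_borel : {set gT}) :|: C.
pose stab := [set x | [forall d in D, (d * x)%g \in D]].
have stab_group : group_set stab.
  apply/andP; split; first by rewrite inE; apply/forall_inP=> d Dd; rewrite mulg1.
  apply/subsetP=> _ /imset2P[x y + + ->]; rewrite !inE => /forall_inP Sx /forall_inP Sy.
  by apply/forall_inP=> d /Sx/Sy; rewrite mulgA.
have K_stab k : k \in K -> k \in stab.
  move=> Kk; rewrite inE; apply/forall_inP=> d; rewrite !in_setU => /orP[Kd | Cd].
    by rewrite groupM.
  by rewrite C_K ?orbT.
have W_stab : gW \in stab.
  rewrite inE; apply/forall_inP=> d; rewrite !in_setU => /orP[Kd | ].
    by rewrite K_C ?orbT.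
  case/mulsgP=> _ _ /rcosetP[k Kk ->] /sz_borelP[a [b [l nzl ->]]] ->.
  (* The torus factor passes through [W] at the cost of being inverted. *)
  have -> : (k * gW * (gS a b * gM l) * gW = k * ((gW * gS a b * gW) * gM l^-1))%g.
    by rewrite -gM_conjW // conjgE !mulgA -[in RHS](mulgA _ gW gW^-1)%g mulgV mulg1.
  have [[-> ->] | nz_ab] := eqVneq (a, b) (0, 0).
    by rewrite gS0 mulg1 gWW mul1g groupM ?gM_borel ?invr_eq0.
  by rewrite orbC K_C // C_K ?gWSW ?gM_borel ?invr_eq0.
have sub : H \subset Group stab_group.
  rewrite H_gen gen_subG; apply/subsetP=> g; rewrite inE => gen_g.
  case/or3P: gen_g => [/existsP[a /existsP[b /eqP gE]] | | /eqP gE].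
  - by rewrite (_ : g = gS a b) ?K_stab ?gS_borel //; apply: mx_of_inj; rewrite gSE.
  - case/existsP=> l /andP[nzl /eqP gE].
    by rewrite (_ : g = gM l) ?K_stab ?gM_borel //; apply: mx_of_inj; rewrite gME.
  by rewrite (_ : g = gW) //; apply: mx_of_inj; rewrite gWE.
move=> Hh; have := subsetP sub h Hh; rewrite inE => /forall_inP/(_ 1%g).
by rewrite !in_setU mul1g group1 => ->.
Qed.

(** * Torus elements of the Suzuki group and characters of its Borel subgroup *)

Lemma mul_theta_eq1 (l : F) : l * theta l = 1 -> l = 1.
Proof.
(* Applying [theta] to the equation gives [theta l * l ^+ 2 = 1], which is [l] times the
   equation. *)
move=> ltl; have /(congr1 theta) := ltl; rewrite thetaM theta_theta theta1 => tll.
have : l * (l * theta l) = 1 by rewrite -[RHS]tll; ring.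
by rewrite ltl mulr1.
Qed.

(** The diagonal is [l * s, s, s^-1, (l * s)^-1]. As squaring is injective, any coincidence reduces
    to [l], [s], [l * s] or [l * theta l] being 1, each of which forces [l = 1]. *)
Lemma sz_M_eigen_neq (l : F) : l != 0 -> l != 1 -> injective (fun r : 'I_4 => sz_M n l r r).
Proof.
move=> nzl l1; set s := sqrt_theta l.
have nzs : s != 0 by rewrite sqrt_theta_eq0.
have lss : l * s * s != 1.
  by apply: contra l1 => /eqP; rewrite -mulrA -expr2 sqrt_thetaE => /mul_theta_eq1->.
have s1 : s != 1.
  apply: contra l1 => /eqP s1; apply/eqP/theta_inj.
  by rewrite theta1 -sqrt_thetaE -/s s1 expr1n.
have ss : s * s != 1 by apply: contra s1 => /eqP ss; apply/eqP/sqr_inj; rewrite expr2 ss expr1n.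
have ls : l * s != 1.
  apply: contra l1 => /eqP/(congr1 theta); rewrite thetaM theta_sqrt theta1 mulrC.
  by move/mul_theta_eq1->.
have lsls : (l * s) * (l * s) != 1.
  by apply: contra ls => /eqP lsls; apply/eqP/sqr_inj; rewrite expr2 lsls expr1n.
have e01 : l * s != s.
  by apply: contra l1 => /eqP lsE; apply/eqP/(mulIf nzs); rewrite lsE mul1r.
have e02 : l * s != s^-1 by apply: contra lss => /eqP->; rewrite mulVf.
have e03 : l * s != (l * s)^-1.
  by apply: contra lsls => /eqP lsE; rewrite {1}lsE mulVf // mulf_neq0.
have e12 : s != s^-1 by apply: contra ss => /eqP sE; rewrite {1}sE mulVf.
have e13 : s != (l * s)^-1.
  by apply: contra lss => /eqP sE; rewrite {2}sE mulfV // mulf_neq0.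
have e23 : s^-1 != (l * s)^-1 by rewrite (inj_eq invr_inj) eq_sym.
move=> r c; rewrite sz_ME -/s !mxE.
elim/ord4P: r; elim/ord4P: c => //= /eqP; rewrite ?[_ == l * s]eq_sym;
  by rewrite ?(negPf e01) ?(negPf e02) ?(negPf e03) ?(negPf e12) ?(negPf e13)
    ?(negPf e23) // eq_sym ?(negPf e01) ?(negPf e02) ?(negPf e03) ?(negPf e12)
    ?(negPf e13) ?(negPf e23).
Qed.

(** Conjugacy amounts to two successive affine fixed point equations, of slopes [l^-1] and
    [(l * theta l)^-1], both different from 1. *)
Lemma gS_gM_conj (a b l : F) : l != 0 -> l != 1 ->
  exists c d, (gS a b * gM l)%g = (gS c d * gM l * (gS c d)^-1)%g.
Proof.
move=> nzl l1; have solve (e k : F) : k != 1 -> exists c, e + c / k^-1 = c.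
  move=> k1; exists (e / (1 - k)); rewrite invrK; field.
  by rewrite subr_eq0 eq_sym.
have [|c cE] := solve a l^-1; first by rewrite invr_eq1.
have [|d dE] := solve (b + theta a * (c / l)) (l * theta l)^-1.
  by rewrite invr_eq1; apply: contra l1 => /eqP/mul_theta_eq1->.
rewrite !invrK in cE dE.
exists c, d; apply: (canRL (mulgK _)); rewrite -mulgA gMS // mulgA gSS cE.
by congr (gS _ _ * _)%g; rewrite -[RHS]dE; ring.
Qed.

Lemma Sz_torus_char : exists2 mu : 'CF(sz_borel), mu \is a linear_char &
  (forall a b, mu (gS a b) = 1) /\ exists2 l, l != 0 & mu (gM l) != 1.
Proof.
(* The upper left entry is multiplicative on [sz_borel] and equals 1 on each [gS a b]; the default 1
   is only taken outside [sz_borel]. *)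
pose f (g : gT) : {unit F} := insubd (1%g : {unit F}) (mx_of g o0 o0).
have f00 a b l : l != 0 -> mx_of (gS a b * gM l)%g o0 o0 = l * sqrt_theta l.
  by move=> nzl; rewrite mx_ofM gSE gME // sz_SE sz_ME mulmx4 !mxE /=; ring.
have fE g : g \in sz_borel -> val (f g) = mx_of g o0 o0.
  case/sz_borelP=> a [b [l nzl ->]]; rewrite insubdK // unfold_in /= f00 //.
  by rewrite unitfE mulf_neq0 ?sqrt_theta_eq0.
have fM : {in sz_borel &, {morph f : x y / (x * y)%g}}.
  move=> x y Kx Ky; apply: val_inj; rewrite fE ?groupM //= !fE //.
  case/sz_borelP: Kx => a [b [l nzl ->]]; case/sz_borelP: Ky => c [d [m nzm ->]].
  rewrite !f00 // mulgA -(mulgA (gS a b)) gMS // mulgA gSS -mulgA gMM //.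
  rewrite f00 ?mulf_neq0 //; have -> : sqrt_theta (l * m) = sqrt_theta l * sqrt_theta m.
    exact: exprMn.
  by ring.
pose phi := Morphism fM.
(* The field has more than 2 elements because [0 < n]. *)
have [l nzl l1] : exists2 l : F, l != 0 & l != 1.
  apply/exists_inP; apply: contraT; rewrite negb_exists_in => /forall_inP l01.
  have : (#|F| <= #|pred2 (0%R : F) 1%R|)%N.
    apply/subset_leq_card/subsetP=> x _; rewrite !inE; case: eqP => //= /eqP nzx.
    by have := l01 x nzx; rewrite negbK.
  rewrite card_F leqNgt card2 (leq_ltn_trans (_ : _ <= 2)%N) //; first by case: eqP.
  by rewrite -{1}(expn1 2) ltn_exp2l //; lia.
have Kl := gM_borel nzl.
have f_l1 : phi (gM l) != 1%g.
  apply/eqP=> /(congr1 val); rewrite /= fE // -[gM l]mul1g -gS0 f00 // => lsl.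
  case/negP: l1; apply/eqP; apply: mul_theta_eq1.
  by rewrite -{1}(theta_sqrt l) -thetaM mulrC lsl theta1.
have [i ker_i] : exists i : Iirr (phi @* sz_borel), phi (gM l) \notin cfker 'chi_i.
  apply/existsP; apply: contraT; rewrite negb_exists => /forallP ker.
  case/eqP: f_l1; apply/set1gP; rewrite -(TI_cfker_irr (phi @* sz_borel)%G).
  by apply/bigcapP=> i _; have := ker i; rewrite negbK.
have lin_i : 'chi_i \is a linear_char.
  by apply/char_abelianP/cyclic_abelian/field_unit_group_cyclic.
exists (cfMorph 'chi_i); first exact: cfMorph_lin_char.
split=> [a b | ].
  rewrite cfMorphE ?gS_borel //= (_ : f _ = 1%g) ?lin_char1 //.
  apply: val_inj; rewrite fE ?gS_borel //= -[gS a b]mulg1 -gM1 f00 ?oner_eq0 //.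
  by rewrite sqrt_theta1 mulr1.
exists l => //; rewrite cfMorphE //=; apply: contra ker_i => /eqP chi1.
by rewrite cfkerEirr inE lin_char1 // -[phi _]/(f _) chi1.
Qed.

(** * The final count *)

Lemma leq_cell_count (q k b : nat) : (8 <= q -> k <= q ^ 2 * q.-1 ->
  k * b * 8 + q ^ 2 * 8 * b <= q ^ 4 * b)%N.
Proof.
case: q => // q q8 leq_k.
have -> : (k * b * 8 + q.+1 ^ 2 * 8 * b = 8 * (k + q.+1 ^ 2) * b)%N by ring.
rewrite leq_mul2r; apply/orP; right.
have leq_kq : (k + q.+1 ^ 2 <= q.+1 ^ 3)%N by move: leq_k; rewrite expnSr /=; lia.
by rewrite [(_ ^ 4)%N]expnS leq_mul.
Qed.

Lemma Sp4_Sz_not_strong_gelfand : ~ strong_gelfand G H.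
Proof.
move=> sgGH; have [mu lin_mu [mu_S [l0 nzl0 mu_l0]]] := Sz_torus_char.
have sKH := sz_borel_sub; have sHG := Sz_sub_Sp4; have sBG := borel_sub.
have sKG := subset_trans sKH sHG.
have norm_theta : '['Ind[H] mu] <= 1.
  rewrite -[leRHS]/(1%:R) -card_unit.
  apply: (cfdot_Ind_le sKH sKH lin_mu lin_mu (w := fun _ => 1%g)) => h Hh agree.
  exists tt; rewrite mulg1 mulGid; case/orP: (Sz_bruhat Hh) => //.
  case/mulsgP=> _ k2 /rcosetP[k1 Kk1 ->] Kk2 hE.
  (* A square root of [l0]. Conjugation by an element of [K W K] inverts the torus part, so
     agreement at a conjugate of [gM k] would make [mu] equal to 1 at [gM (k * k) = gM l0]. *)
  pose k := sqrt_theta (sqrt_theta l0).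
  have kk : k * k = l0 by rewrite -expr2 sqrt_thetaE theta_sqrt.
  have nzk : k != 0 by rewrite !sqrt_theta_eq0.
  have Kk := gM_borel nzk; have KkV : gM k^-1 \in sz_borel by rewrite gM_borel ?invr_eq0.
  have xh : ((gM k ^ k1^-1) ^ h)%g = (gM k^-1 ^ k2)%g.
    by rewrite hE -!conjgM !mulgA mulVg mul1g conjgM gM_conjW.
  have /forall_inP/(_ (gM k ^ k1^-1)%g) := agree.
  rewrite in_setI mem_conjgV xh !groupJ ?groupV // => /(_ isT).
  rewrite !cfunJ ?groupV // -gMV // lin_charV_conj // conjCK -lin_charM //.
  by rewrite gMM // kk (negPf mu_l0).
have norm_pi : '['Ind[G] (1 : 'CF(borel))] <= 8%:R.
  rewrite -card_weyl_index -(card_sig (fun ij => weyl_index ij)).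
  apply: (cfdot_Ind_le sBG sBG (cfun1_lin_char _) (cfun1_lin_char _)
    (w := fun ij : {ij | weyl_index ij} => weyl (val ij))) => g Gg _.
  by have [ij Wij Bg] := Sp4_bruhat Gg; exists (exist _ ij Wij).
have le8 : '['Ind[G] mu, 'Ind[G] (1 : 'CF(borel))] <= 8%:R.
  rewrite -(cfIndInd _ sHG sKH).
  apply: le_trans (strong_gelfand_cfdot_Ind sgGH _ _) _.
  - by rewrite cfInd_char ?lin_charW.
  - by rewrite cfInd_char ?rpred1.
  apply: le_trans (_ : 1 * 8%:R <= _); last by rewrite mul1r.
  by rewrite ler_pM ?cfnorm_ge0.
pose good := [set g in G | mackey_agree mu (1 : 'CF(borel)) g].
(* Elements whose coset of [borel] is a coordinate flag moved by some [gS c d], the flags that a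
   conjugate of a nontrivial [gM l] may fix. *)
pose bad := [set (gS p.1.1.1 p.1.1.2 * weyl p.1.2 * p.2)%g
  | p in setX (setX [set: F * F] [set ij | weyl_index ij]) borel].
have card_good : (#|good| <= #|sz_borel| * #|borel| * 8)%N.
  rewrite -(ler_nat algC) natrM.
  apply: le_trans (cfdot_Ind_ge sKG sBG lin_mu (cfun1_lin_char _)) _.
  by rewrite ler_wpM2l ?ler0n.
have card_bad : (#|bad| <= #|F| ^ 2 * 8 * #|borel|)%N.
  apply: leq_trans (leq_imset_card _ _) _.
  by rewrite !cardsX cardsT card_prod mulnn cardsE card_weyl_index.
have cover : G \subset good :|: bad.
  apply/subsetP=> g Gg; rewrite inE orbC -implyNb; apply/implyP=> not_bad.
  rewrite inE Gg; apply/forall_inP=> x; rewrite in_setI mem_conjgV => /andP[Kx Bx].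
  rewrite cfun1E Bx conjC1 mulr1.
  case/sz_borelP: Kx => a [b [l nzl xE]].
  (* A unipotent [x] satisfies [mu x = 1]; any other [x] is conjugate by some [gS c d] to [gM l],
     which has distinct eigenvalues and puts [g] in [bad]. *)
  have [l1 | l1] := eqVneq l 1; first by rewrite xE l1 gM1 mulg1 mu_S.
  case/negP: not_bad; have [c [d xE']] := gS_gM_conj a b nzl l1.
  have Gu : gS c d \in G by apply: (subsetP sHG); apply: gS_H.
  have [|||ij Wij By] := @conj_diag_borel (gM l) ((gS c d)^-1 * g)%g _ _
    (sz_M_eigen_neq nzl l1).
  - by rewrite groupM ?groupV.
  - move=> r s; rewrite gME // sz_ME !mxE -val_eqE.
    by elim/ord4P: r; elim/ord4P: s.
  - have -> : (gM l ^ ((gS c d)^-1 * g) = x ^ g)%g; last by [].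
    by rewrite conjgM xE xE' [(gM l ^ _)%g]conjgE invgK mulgA.
  apply/imsetP; exists (c, d, ij, ((weyl ij)^-1 * ((gS c d)^-1 * g))%g).
    by rewrite !in_setX in_setT By andbT inE.
  by rewrite /= -mulgA !mulKVg.
have := leq_trans (subset_leq_card cover) (leq_card_setU _ _).
rewrite leqNgt => /negP[]; apply: leq_ltn_trans card_Sp4_gt.
apply: leq_trans (leq_add card_good card_bad) _.
apply: leq_cell_count card_sz_borel.
by rewrite card_F -[8%N]/(2 ^ 3)%N leq_exp2l // addn1 ltnS leq_pmulr.
Qed.
End MatrixGroups.

Theorem theorem5p5 (F : finFieldType) (n : nat) :
  (0 < n)%N -> #|F| = (2 ^ (2 * n + 1))%N ->
  Sz F n \subset Sp4 F /\ ~ strong_gelfand (Sp4 F) (Sz F n).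
Proof.
move=> n_gt0 card_F.
have F2 : 2%:R = 0 :> F.
  have /pcharf0 // : 2%N \in [pchar F] by apply: (card_finPcharP card_F).
(* The abstract representation is instantiated by [GLval]; singular matrices are sent to 1. *)
pose of_mx (A : 'M[F]_4) : {'GL_4[F]} := insubd (1%g : {'GL_4[F]}) A.
have mx_of_inj : injective (@GLval 4 F) by apply: val_inj.
have mx_of1 : @GLval 4 F 1%g = 1%:M by apply: GL_1E.
have mx_ofM (g h : {'GL_4[F]}) : GLval (g * h)%g = GLval g *m GLval h.
  exact: GL_MxE.
have of_mxK (A : 'M[F]_4) : A \in unitmx -> GLval (of_mx A) = A.
  by move=> uA; apply: insubdK.
have mem_G (g : {'GL_4[F]}) :
    (g \in Sp4 F) = ((GLval g)^T *m Jform F *m GLval g == Jform F).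
  by rewrite inE.
have sHG := Sz_sub_Sp4 F2 mem_G (erefl : Sz F n = _ :> {set _}).
split; first exact: sHG.
exact: (Sp4_Sz_not_strong_gelfand F2 card_F mx_of_inj mx_of1 mx_ofM of_mxK
  mem_G n_gt0 (erefl : Sz F n = _ :> {set _})).
Qed.
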